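(* Let $\Phi$ be an Orlicz function such that $$\limsup_{u\to\infty}\Phi(u)u^{-2}=\infty.$$ Then the Orlicz space $L_\Phi$ on $[0,1]$ does not have the property (IR).
   Context: Functions are real-valued and Lebesgue measurable on $[0,1]$; independence is with respect to Lebesgue measure. Orlicz function: a strictly increasing, convex, continuous $\Phi:[0,\infty)\to[0,\infty)$ with $\Phi(0)=0$, $\Phi(1)=1$. Orlicz space $L_\Phi$: all measurable $x$ on $[0,1]$ with finite Luxemburg norm $\|x\|_{L_\Phi}:=\inf\{\lambda>0:\int_0^1\Phi(|x(t)|/\lambda)\,dt\le1\}$. Kolmogorov width: $d_n(K,X):=\inf_{\dim V\le n}\sup_{x\in K}\inf_{v\in V}\|x-v\|_X$, the infimum over linear subspaces $V\subset X$ of dimension at most $n$; for non-integer $r$, $d_r:=d_{\lfloor r\rfloor}$. Property (IR): a space $X$ of functions on $[0,1]$ has the property (IR) if there exists $\gamma>0$ such that for any $N\in\mathbb N$ and arbitrary independent functions $f_1,\ldots,f_N\in X$ with $\int_0^1f_k(x)\,dx=0$ and $\|f_k\|_X\ge1$, $k=1,\ldots,N$, we have $d_{\gamma N}(\{f_1,\ldots,f_N\},X)\ge\gamma$. *)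

(* Defs.v *)
From HB Require Import structures.
From mathcomp Require Import all_boot all_order all_algebra.
From mathcomp Require Import all_classical all_reals all_analysis.

Set Implicit Arguments.
Unset Strict Implicit.
Unset Printing Implicit Defensive.

Import Order.TTheory GRing.Theory Num.Theory.
Import numFieldNormedType.Exports.

Local Open Scope classical_set_scope.
Local Open Scope ring_scope.

(* The real line with the sigma-algebra of Lebesgue (rather than Borel)
   measurable sets, on which [completed_lebesgue_measure] is defined. *)
Definition lebesgueR (R : realType) : measurableType _ :=
  caratheodory_type (mu_ext (wlength (R := R) idfun)).

Local Notation leb := completed_lebesgue_measure.

Definition unit_itv (R : realType) : set (lebesgueR R) := [set` `[0%R, 1%R]].

(* Functions on [0, 1] are total functions on the line whose values outside
   [0, 1] are never used. *)
Local Notation fct01 R := (lebesgueR R%type -> R%type).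

Section Orlicz.
Context {R : realType}.
Implicit Types (Phi : R -> R) (f x : fct01 R).

(* Only the values of Phi on [0, +oo[ are constrained, or used below. *)
Record orlicz_function Phi : Prop := OrliczFunction {
  orlicz_ge0 : {in `[0, +oo[, forall u, 0 <= Phi u} ;
  orlicz_increasing : {in `[0, +oo[ &, {homo Phi : u v / u < v}} ;
  orlicz_convex : convex_function (E := R^o) `[0, +oo[%classic Phi ;
  orlicz_continuous : {within `[0, +oo[, continuous Phi} ;
  orlicz0 : Phi 0 = 0 ;
  orlicz1 : Phi 1 = 1 }.

(* +oo when no lambda is admissible. *)
Definition luxemburg_norm Phi x : \bar R :=
  ereal_inf [set l%:E | l in [set l : R | 0 < l /\
    (\int[leb]_(t in @unit_itv R) (Phi (`|x t| / l))%:E <= 1)%E]].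

Definition orlicz_space Phi : set (fct01 R) :=
  [set x | measurable_fun (@unit_itv R) x /\ (luxemburg_norm Phi x < +oo)%E].

End Orlicz.

(* In this section a space of functions on [0, 1], whose elements are understood
   up to almost everywhere equality, is given by the set X of its representatives
   and its norm nrm, which may take the value +oo outside X. *)
Section Width.
Context {R : realType}.
Variables (X : set (fct01 R)) (nrm : fct01 R -> \bar R).
Implicit Types (V K : set (fct01 R)) (n : nat).

Definition linear_subspace V : Prop :=
  [/\ V `<=` X, V (fun=> 0) &
      forall (a : R) (f g : fct01 R), V f -> V g -> V (fun t => a * f t + g t)].

(* The dimension is that of the space of classes modulo a.e. equality. *)
Definition dim_le V n : Prop :=
  exists g : 'I_n -> fct01 R, (forall i, V (g i)) /\
    forall v, V v -> exists c : 'I_n -> R,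
      ae_eq leb (@unit_itv R) v (fun t => \sum_(i < n) c i * g i t).

Definition kolmogorov_width n K : \bar R :=
  ereal_inf [set ereal_sup [set ereal_inf [set nrm (x \- v) | v in V] | x in K]
            | V in [set V | linear_subspace V /\ dim_le V n]].

Definition independent01 N (f : 'I_N -> fct01 R) : Prop :=
  forall B : 'I_N -> set R, (forall k, measurable (B k)) ->
    leb (@unit_itv R `&` \bigcap_(k in [set: 'I_N]) (f k @^-1` B k)) =
    (\prod_(k < N) leb (@unit_itv R `&` (f k @^-1` B k)))%E.

(* N = 0 is excluded: the supremum over the empty family is -oo in \bar R.
   As gamma * N is nonnegative, its floor is [Num.truncn]. *)
Definition property_IR : Prop :=
  exists2 gamma : R, 0 < gamma &
    forall (N : nat) (f : 'I_N -> fct01 R), (0 < N)%N ->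
      (forall k, X (f k)) ->
      independent01 f ->
      (forall k, \int[leb]_(t in @unit_itv R) (f k t)%:E = 0)%E ->
      (forall k, 1 <= nrm (f k))%E ->
      (gamma%:E <= kolmogorov_width (Num.truncn (gamma * N%:R)) (range f))%E.

End Width.

(* Main.v *)
Require Import Defs.
From mathcomp Require Import all_boot all_order all_algebra.
From mathcomp Require Import all_classical all_reals all_analysis.
From mathcomp Require Import ring lra zify.

Set Implicit Arguments.
Unset Strict Implicit.
Unset Printing Implicit Defensive.

Import Order.TTheory GRing.Theory Num.Theory.
Import numFieldNormedType.Exports.
Local Open Scope classical_set_scope.
Local Open Scope ring_scope.

(* Take f_k = u xi_k with xi_k independent copies of a symmetric variable with
   values in {-1, 0, 1}, nonzero with probability 1/q, where q is the integral
   part of Phi u; then f_k has norm at least 1. As u^2/q can be made as small as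
   desired, it suffices to write xi_k = v_k + s_k + r_k, where the v_k span a
   space of dimension at most gamma N, |s_k| is at most a small multiple of 1/u,
   |r_k| <= 1 and the variance of r_k is as small as desired, with no control in
   terms of u. The variance is decreased in steps. Given independent copies r_1,
   r_2, ... of the rest r, let A be the Gram matrix of b orthonormal bases of
   one space, each two of which are nearly orthogonal. Its rank is 1/b times its
   size, so the functions (A r)_k are affordable; and (A r)_k - r_k is a sum of
   many independent terms with small coefficients, of variance at most b times
   that of r, which exceeds a truncation level T with small probability only.
   The part below T is added to s, the part above T is the new rest. The numbers
   1/b and T of the successive steps are summable. *)

(** * Averages over finite uniform probability spaces *)

Definition avg (R : realType) (T : finType) (F : T -> R) : R :=
  (\sum_t F t) / #|T|%:R.

Section Average.
Context {R : realType}.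
Implicit Types (T K : finType).

Lemma eq_avg T (F G : T -> R) : F =1 G -> avg F = avg G.
Proof. by move=> FG; rewrite /avg; under eq_bigr do rewrite FG. Qed.

Lemma ler_avg T (F G : T -> R) : (forall t, F t <= G t) -> avg F <= avg G.
Proof.
move=> FG; rewrite /avg ler_wpM2r ?invr_ge0 ?ler0n //.
by apply: ler_sum => t _; exact: FG.
Qed.

Lemma avgZ T (a : R) (F : T -> R) : avg (fun t => a * F t) = a * avg F.
Proof. by rewrite /avg -mulr_sumr mulrA. Qed.

Lemma avgD T (F G : T -> R) : avg (fun t => F t + G t) = avg F + avg G.
Proof. by rewrite /avg big_split mulrDl. Qed.

Lemma avg_sum T K (F : K -> T -> R) :
  avg (fun t => \sum_k F k t) = \sum_k avg (F k).
Proof. by rewrite /avg exchange_big mulr_suml. Qed.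

Lemma avg_cst T (a : R) : (0 < #|T|)%N -> avg (fun _ : T => a) = a.
Proof.
move=> T0; rewrite /avg sumr_const -[a *+ _]mulr_natr -mulrA mulfV ?mulr1 //.
by rewrite pnatr_eq0 -lt0n.
Qed.

(** An injective self-map of a finite type is a bijection, so reindexing by [tau] turns the sum into
    its opposite. *)
Lemma avg_odd T (tau : T -> T) (F : T -> R) :
  injective tau -> (forall t, F (tau t) = - F t) -> avg F = 0.
Proof.
move=> tau_inj Fodd; rewrite /avg.
suff -> : \sum_t F t = 0 by rewrite mul0r.
have : \sum_t F t = - \sum_t F t.
  by rewrite {1}(reindex_inj tau_inj) -sumrN; apply: eq_bigr => t _; exact: Fodd.
by move=> h; lra.
Qed.

(** Distributivity; it says that the coordinates of a finite product space are independent. *)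
Lemma avg_prod T K (F : K -> T -> R) :
  avg (fun om : {ffun K -> T} => \prod_k F k (om k)) = \prod_k avg (F k).
Proof.
rewrite /avg big_split /= bigA_distr_bigA /= card_ffun natrX; congr (_ * _).
by rewrite prodr_const exprVn.
Qed.

End Average.

(** * Elementary inequalities for the exponential *)

Section Exponential.
Context {R : realType}.
Implicit Types (x y : R).

(** From exp(-y) >= 1 - y follows exp(y) <= 1/(1 - y), and (1 + y + 2y^2)(1 - y) = 1 + y^2(1 - 2y)
    is at least 1. *)
Lemma expR_le_quadratic y : `|y| <= 2^-1 -> expR y <= 1 + y + 2 * y ^+ 2.
Proof.
rewrite ler_norml => /andP[ly uy].
have h := expR_ge1Dx (- y).
have y1 : 0 < 1 - y by lra.
rewrite -[expR y]invrK -expRN.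
apply: (@le_trans _ _ (1 - y)^-1).
  by rewrite lef_pV2 ?posrE ?expR_gt0.
rewrite -[leLHS]mul1r ler_pdivrMr //.
have := mulr_ge0 (sqr_ge0 y) (_ : 0 <= 1 - 2 * y); nra.
Qed.

(** For y >= 0, raise y/4 <= 1 + y/4 <= exp(y/4) to the fourth power; the second exponential covers
    y < 0. *)
Lemma expr4_le_expR y : y ^+ 4 <= 256 * (expR y + expR (- y)).
Proof.
wlog y0 : y / 0 <= y.
  move=> wl; case: (leP 0 y) => y0; first exact: wl.
  have := wl (- y); rewrite opprK addrC exprNn -signr_odd /= mul1r.
  by apply; lra.
have h : (y / 4) ^+ 4 <= expR y.
  rewrite [in leRHS](_ : y = y / 4 * 4%:R); last by field.
  rewrite expRM_natr lerXn2r ?nnegrE ?expR_ge0 ?divr_ge0 //.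
  by apply: le_trans (expR_ge1Dx _); lra.
have := expR_ge0 (- y); rewrite expr_div_n in h.
have -> : y ^+ 4 = 256 * (y ^+ 4 / 4 ^+ 4) by field.
by move=> h'; nra.
Qed.

End Exponential.

(** * Many nearly orthogonal orthonormal bases of one space *)

Section FlatSystem.
Context {R : realType}.

Definition gram (K J : finType) (X : K -> J -> R) (k l : K) : R :=
  \sum_j X k j * X l j.

(* b orthonormal bases of R^J, each two of which are nearly orthogonal. *)
Definition flat_system (b g : nat) (K J : finType) (X : K -> J -> R) : Prop :=
  [/\ #|K| = (b * #|J|)%N, forall k, gram X k k = 1,
      forall k l, k != l -> `|gram X k l| <= 2^-1 ^+ g &
      forall k, \sum_l gram X k l ^+ 2 <= b%:R].

(* The identity matrix of order 4, or the reflection I - J/2 where J is the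
   matrix of ones. *)
Definition flat_factor (tilt : bool) (a t : 'I_4) : R :=
  (a == t)%:R - (if tilt then 2^-1 else 0).

(** The reflection is symmetric and squares to the identity, so a product of two factors is tilted
    exactly when one of them is tilted and the other is not. *)
Lemma sum_flat_factor tilt tilt' a a' :
  \sum_t flat_factor tilt a t * flat_factor tilt' a' t =
  flat_factor (tilt (+) tilt') a a'.
Proof.
rewrite !big_ord_recl big_ord0 /flat_factor -!val_eqE /=.
by case: tilt tilt' a a' => -[] [[|[|[|[|a]]]] // ?] [[|[|[|[|a']]]] // ?] /=; lra.
Qed.

Lemma norm_flat_factor tilt a a' :
  `|flat_factor tilt a a'| <= (if tilt then 2^-1 else 1).
Proof. by rewrite /flat_factor ler_norml; case: tilt (a == a') => -[] /=; lra. Qed.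

Section Tensor.
Variables (b g : nat).
Let J := {ffun 'I_b * 'I_g -> 'I_4}.
Let K := ('I_b * J)%type.

(** The row (i, a) is the a-th vector of the i-th basis: the rows of a tensor product of b blocks of
    g factors each, tilted in the i-th block only. *)
Definition tensor_row (k : K) (f : J) : R :=
  \prod_p flat_factor (p.1 == k.1) (k.2 p) (f p).

Lemma gram_tensor_row (k l : K) : gram tensor_row k l =
  \prod_p flat_factor ((p.1 == k.1) (+) (p.1 == l.1)) (k.2 p) (l.2 p).
Proof.
under [RHS]eq_bigr do rewrite -sum_flat_factor.
rewrite bigA_distr_bigA; apply: eq_bigr => f _.
by rewrite /tensor_row -big_split.
Qed.

(** Between different bases, each of the g factors in block i contributes at most 1/2 to the inner
    product, the others at most 1. Parseval's identity in each of the b bases gives the bound on the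
    sum of squares. *)
Lemma flat_tensor_row : flat_system b g tensor_row.
Proof.
split.
- by rewrite card_prod card_ord.
- move=> k; rewrite gram_tensor_row big1 // => p _.
  by rewrite addbb /flat_factor eqxx subr0.
- move=> [i a] [i' a'] /=; rewrite xpair_eqE gram_tensor_row normr_prod /=.
  have [<-{i'} /=|ii' _] := eqVneq i i'.
    move=> aa'; have [p ap] : exists p, a p != a' p.
      apply/existsP; apply: contraR aa' => /existsPn h.
      by apply/eqP/ffunP => p; apply/eqP; have := h p; rewrite negbK.
    rewrite (bigD1 p) //= addbb /flat_factor (negbTE ap) subr0 normr0 mul0r.
    by rewrite exprn_ge0 // invr_ge0.
  apply: (@le_trans _ _ (\prod_(p : 'I_b * 'I_g) (if p.1 == i then 2^-1 else 1))).
    apply: ler_prod => p _; rewrite normr_ge0 /=.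
    apply: le_trans (norm_flat_factor _ _ _) _.
    have [->|_] := eqVneq p.1 i; first by rewrite (negbTE ii').
    by case: ifP => // _; lra.
  rewrite -big_mkcond (eq_bigl (fun p => (p.1 == i) && xpredT p.2)) /=; last first.
    by move=> p; rewrite andbT.
  by rewrite -(pair_big (pred1 i) xpredT (fun _ _ => 2^-1)) /= big_pred1_eq prodr_const card_ord.
- move=> [i a].
  rewrite -(pair_big xpredT xpredT (fun i' a' => gram tensor_row (i, a) (i', a') ^+ 2)) /=.
  rewrite -[b in leRHS]card_ord -sumr_const; apply: ler_sum => i' _.
  under eq_bigr do rewrite gram_tensor_row /= -prodrXl.
  rewrite -(bigA_distr_bigA (fun p t => flat_factor ((p.1 == i) (+) (p.1 == i')) (a p) t ^+ 2)).
  rewrite big1 // => p _; under eq_bigr do rewrite expr2.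
  by rewrite sum_flat_factor addbb /flat_factor eqxx subr0.
Qed.

End Tensor.
End FlatSystem.

(** * One reduction of the variance by means of a Gram matrix *)

Section CrossTerm.
Context {R : realType}.
Variables (Om K J : finType) (tau : Om -> Om) (r : Om -> R) (sg : R).
Variables (b g : nat) (X : K -> J -> R).
Hypothesis Om_gt0 : (0 < #|Om|)%N.
Hypothesis tau_inj : injective tau.
Hypothesis r_odd : forall om, r (tau om) = - r om.
Hypothesis r_le1 : forall om, `|r om| <= 1.
Hypothesis r_var : avg (fun om => r om ^+ 2) <= sg.
Hypothesis X_flat : flat_system b g X.

Lemma sg_ge0 : 0 <= sg.
Proof.
apply: le_trans r_var; rewrite -(avg_cst 0 Om_gt0).
by apply: ler_avg => om; exact: sqr_ge0.
Qed.

(** The linear term of [expR_le_quadratic] has average 0 by oddness. *)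
Lemma avg_expR_le (y : R) : `|y| <= 2^-1 ->
  avg (fun om => expR (y * r om)) <= expR (2 * y ^+ 2 * sg).
Proof.
move=> y2; apply: le_trans (expR_ge1Dx _).
have h om : expR (y * r om) <= 1 + (y * r om + (2 * y ^+ 2) * r om ^+ 2).
  have -> : 1 + (y * r om + 2 * y ^+ 2 * r om ^+ 2) =
            1 + y * r om + 2 * (y * r om) ^+ 2 by ring.
  apply: expR_le_quadratic; rewrite normrM; apply: le_trans y2.
  by rewrite ler_piMr.
apply: le_trans (ler_avg h) _.
rewrite !avgD avg_cst // !avgZ (avg_odd tau_inj r_odd) mulr0 add0r.
by rewrite lerD2l ler_wpM2l // mulr_ge0 // sqr_ge0.
Qed.

(** For the Gram matrix A, whose diagonal is 1, this is (A r)_k - r_k, on the product of [K] copies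
    of [Om]. *)
Definition cross (k : K) (om : {ffun K -> Om}) : R :=
  \sum_(l | l != k) gram X k l * r (om l).

Lemma cross_odd (k : K) (om : {ffun K -> Om}) :
  cross k [ffun l => tau (om l)] = - cross k om.
Proof.
by rewrite /cross -sumrN; apply: eq_bigr => l _; rewrite ffunE r_odd mulrN.
Qed.

(** Independence factorizes the exponential moment. The bound on t keeps every coefficient below
    1/2, as [avg_expR_le] demands, and the squares of the Gram entries sum to at most b. *)
Lemma avg_expR_cross (t : R) (k : K) : `|t| * 2^-1 ^+ g <= 2^-1 ->
  avg (fun om => expR (t * cross k om)) <= expR (2 * t ^+ 2 * b%:R * sg).
Proof.
move=> tg; case: X_flat => _ _ Xoff Xrow.
pose a l := if l == k then 0 else gram X k l.
have a_le l : `|t * a l| <= 2^-1.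
  rewrite normrM /a; have [_|lk] := eqVneq l k; first by rewrite normr0 mulr0 invr_ge0.
  by apply: le_trans tg; rewrite ler_wpM2l // Xoff // eq_sym.
have -> : avg (fun om => expR (t * cross k om)) =
          \prod_l avg (fun om => expR (t * a l * r om)).
  rewrite -avg_prod; apply: eq_avg => om; rewrite -expR_sum; congr expR.
  rewrite /cross mulr_sumr big_mkcond; apply: eq_bigr => l _.
  by rewrite /a; case: eqVneq => _ /=; rewrite ?mulr0 ?mul0r ?mulrA.
apply: (@le_trans _ _ (\prod_l expR (2 * (t * a l) ^+ 2 * sg))).
  apply: ler_prod => l _; rewrite avg_expR_le // andbT.
  rewrite -(avg_cst 0 Om_gt0).
  by apply: ler_avg => om; exact: expR_ge0.
rewrite -expR_sum ler_expR -mulr_suml ler_wpM2r ?sg_ge0 //.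
have -> : \sum_l 2 * (t * a l) ^+ 2 = 2 * t ^+ 2 * \sum_l a l ^+ 2.
  by rewrite mulr_sumr; apply: eq_bigr => l _; rewrite exprMn mulrA.
apply: ler_wpM2l; first by rewrite mulr_ge0 ?sqr_ge0.
apply: le_trans (Xrow k).
apply: ler_sum => l _; rewrite /a; case: eqVneq => // _.
by rewrite expr0n /= sqr_ge0.
Qed.

Variables (y T : R).
Hypothesis y_ge1 : 1 <= y.
Hypothesis y_g : 2 * 2^-1 ^+ g * y ^+ 2 <= 1.
Hypothesis y_sg : 8 * b%:R * y ^+ 2 * sg <= 1.
Hypothesis T_gt0 : 0 < T.

(** Chernoff's bound with exponents y^2 and -y^2: by [y_sg], the exponential moments cost a factor
    of at most exp(y^2/4). *)
Lemma avg_cross_gt1 (k : K) :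
  avg (fun om => (1 < `|cross k om|)%R%:R) <= 2 * expR (- (3 / 4 * y ^+ 2)) :> R.
Proof.
set x := y ^+ 2.
have x0 : 0 <= x by exact: sqr_ge0.
have xg : x * 2^-1 ^+ g <= 2^-1.
  have := y_g; rewrite -/x; set e := _ ^+ g; lra.
have M : expR (2 * x ^+ 2 * b%:R * sg) <= expR (x / 4).
  rewrite ler_expR; have := y_sg; rewrite -/x => h.
  have := ler_wpM2l x0 h; have -> : x * (8 * b%:R * x * sg) = 4 * (2 * x ^+ 2 * b%:R * sg) by ring.
  lra.
have h (om : {ffun K -> Om}) : (1 < `|cross k om|)%R%:R <=
    expR (- x) * (expR (x * cross k om) + expR (- x * cross k om)).
  case: ltP => c1 /=; last by rewrite mulr_ge0 ?addr_ge0 ?expR_ge0.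
  rewrite mulrDr -!expRD.
  have := expR_ge0 (- x + x * cross k om); have := expR_ge0 (- x + - x * cross k om).
  move: c1; rewrite lter_normr => /orP[] c1.
    have := expR_ge1Dx (- x + x * cross k om); nra.
  have := expR_ge1Dx (- x + - x * cross k om); nra.
apply: le_trans (ler_avg h) _; rewrite avgZ avgD.
have -> : - (3 / 4 * x) = - x + x / 4 by lra.
rewrite expRD mulrCA ler_wpM2l ?expR_ge0 //.
have h1 := @avg_expR_cross x k; have h2 := @avg_expR_cross (- x) k.
rewrite normrN sqrrN (ger0_norm x0) in h1 h2.
by have := h1 xg; have := h2 xg; lra.
Qed.

(** The exponential moments at y and -y are at most 2 and control the fourth moment through
    [expr4_le_expR]. *)
Lemma avg_cross4 (k : K) : avg (fun om => cross k om ^+ 4) <= 1024 / y ^+ 4.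
Proof.
have y0 : 0 < y by apply: lt_le_trans y_ge1.
have yg : y * 2^-1 ^+ g <= 2^-1.
  have := y_g; have : 0 <= 2^-1 ^+ g :> R by rewrite exprn_ge0 // invr_ge0.
  have y2 : y <= y ^+ 2 by rewrite expr2 ler_peMr // ltW.
  set e := _ ^+ g => e0; nra.
have M : expR (2 * y ^+ 2 * b%:R * sg) <= 2.
  apply: (@le_trans _ _ (1 + 4^-1 + 2 * 4^-1 ^+ 2)); last by lra.
  apply: (@le_trans _ _ (expR 4^-1)).
    rewrite ler_expR; have := y_sg.
    have -> : 8 * b%:R * y ^+ 2 * sg = 4 * (2 * y ^+ 2 * b%:R * sg) by ring.
    lra.
  by apply: expR_le_quadratic; rewrite ger0_norm; lra.
have h (om : {ffun K -> Om}) : cross k om ^+ 4 <=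
    (256 / y ^+ 4) * (expR (y * cross k om) + expR (- y * cross k om)).
  have := expr4_le_expR (y * cross k om); rewrite exprMn -mulNr => h.
  by rewrite mulrAC ler_pdivlMr ?exprn_gt0 // mulrC.
apply: le_trans (ler_avg h) _; rewrite avgZ avgD.
have -> : 1024 / y ^+ 4 = (256 / y ^+ 4) * 4 by field; lra.
rewrite ler_wpM2l ?divr_ge0 ?exprn_ge0 ?(ltW y0) //.
have h1 := @avg_expR_cross y k; have h2 := @avg_expR_cross (- y) k.
rewrite normrN sqrrN (ger0_norm (ltW y0)) in h1 h2.
by have := h1 yg; have := h2 yg; lra.
Qed.

(** One event for all k: the factor that multiplies A r must not depend on k, so that the products
    stay in the span of #|J| functions. *)
Definition cross_good (om : {ffun K -> Om}) : bool := [forall k, `|cross k om| <= 1].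

Definition new_tame (k : K) (om : {ffun K -> Om}) : R :=
  - (if cross_good om && (`|cross k om| <= T) then cross k om else 0).

Definition new_rest (k : K) (om : {ffun K -> Om}) : R :=
  if cross_good om then - (if T < `|cross k om| then cross k om else 0) else r (om k).

Lemma norm_new_tame k om : `|new_tame k om| <= T.
Proof.
rewrite /new_tame normrN; case: ifP => [/andP[]//|_].
by rewrite normr0 ltW.
Qed.

Lemma norm_new_rest k om : `|new_rest k om| <= 1.
Proof.
rewrite /new_rest; case: ifP => [/forallP/(_ k) h|_]; last exact: r_le1.
by case: ifP; rewrite normrN // normr0.
Qed.

Lemma cross_good_odd (om : {ffun K -> Om}) :
  cross_good [ffun l => tau (om l)] = cross_good om.
Proof. by apply: eq_forallb => k; rewrite cross_odd normrN. Qed.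

Lemma new_rest_odd k (om : {ffun K -> Om}) :
  new_rest k [ffun l => tau (om l)] = - new_rest k om.
Proof.
rewrite /new_rest cross_good_odd cross_odd normrN ffunE r_odd.
by case: ifP => // _; case: ifP => // _; rewrite !oppr0.
Qed.

(** On the good event r_k = (A r)_k - cross_k. As A is [X] times its transpose, (A r)_k is a
    combination of #|J| functions common to all k. Off this event, r_k is kept whole as the rest. *)
Lemma new_decomposition k (om : {ffun K -> Om}) : r (om k) =
  (\sum_j X k j * ((cross_good om)%:R * \sum_l X l j * r (om l))) +
  new_tame k om + new_rest k om.
Proof.
have -> : \sum_j X k j * ((cross_good om)%:R * \sum_l X l j * r (om l)) =
    (cross_good om)%:R * (r (om k) + cross k om).
  under eq_bigr do rewrite mulrCA mulr_sumr.
  rewrite -mulr_sumr exchange_big; congr (_ * _) => /=.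
  rewrite (bigD1 k) //= /cross; congr (_ + _).
    case: X_flat => _ Xd _ _; rewrite -[RHS]mul1r -(Xd k) mulr_suml.
    by apply: eq_bigr => j _; rewrite mulrA.
  apply: eq_bigr => l _; rewrite mulr_suml.
  by apply: eq_bigr => j _; rewrite mulrA.
rewrite /new_tame /new_rest; case: cross_good => /=; last by rewrite mul0r oppr0; ring.
by rewrite mul1r; case: leP => _; ring.
Qed.

(** On the good event, the square of [cross] above the level [T] is at most its fourth power over
    T^2. Elsewhere the rest is bounded by 1, and the union bound over [K] applies. *)
Lemma avg_new_rest k : avg (fun om => new_rest k om ^+ 2) <=
  1024 / (T * y ^+ 2) ^+ 2 + 2 * #|K|%:R * expR (- (3 / 4 * y ^+ 2)).
Proof.
have h (om : {ffun K -> Om}) : new_rest k om ^+ 2 <=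
    (T ^+ 2)^-1 * cross k om ^+ 4 + \sum_l (1 < `|cross l om|)%R%:R.
  have s0 : 0 <= \sum_l (1 < `|cross l om|)%R%:R :> R by exact: sumr_ge0.
  have T2 : 0 < T ^+ 2 by rewrite exprn_gt0.
  have c0 : 0 <= (T ^+ 2)^-1 * cross k om ^+ 4.
    by rewrite mulr_ge0 ?invr_ge0 ?(ltW T2) // (exprM _ 2 2) sqr_ge0.
  rewrite /new_rest; case: ifP => [_|/negbT].
    rewrite sqrrN; case: ifP => [Tc|_]; last by rewrite expr0n /= addr_ge0.
    apply: ler_wpDr => //; rewrite mulrC ler_pdivlMr // (exprD _ 2 2).
    rewrite ler_wpM2l ?sqr_ge0 // -[leRHS]real_normK ?num_real //.
    by rewrite lerXn2r ?nnegrE ?(ltW T_gt0) // ltW.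
  move=> /forallPn[l]; rewrite -ltNge => cl.
  apply: (@le_trans _ _ 1).
    by rewrite -real_normK ?num_real // exprn_ile1.
  rewrite (bigD1 l) //= cl addrCA lerDl addr_ge0 //; exact: sumr_ge0.
apply: le_trans (ler_avg h) _; rewrite avgD avgZ avg_sum; apply: lerD.
  have -> : 1024 / (T * y ^+ 2) ^+ 2 = (T ^+ 2)^-1 * (1024 / y ^+ 4).
    have yn0 : y != 0 by rewrite gt_eqF // (lt_le_trans _ y_ge1).
    by field; rewrite yn0 (gt_eqF T_gt0).
  by rewrite ler_wpM2l ?invr_ge0 ?sqr_ge0 // avg_cross4.
apply: (@le_trans _ _ (\sum_(l : K) 2 * expR (- (3 / 4 * y ^+ 2)))).
  by apply: ler_sum => l _; exact: avg_cross_gt1.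
by rewrite sumr_const -[leLHS]mulr_natr mulrAC.
Qed.

End CrossTerm.

(** * Approximation schemes and their improvement by one step *)

Section Scheme.
Context {R : realType}.

(* A family xi of independent copies of xi0 on a finite uniform probability
   space, approximated by combinations of few functions w up to a part s bounded
   by S and a part r of small variance. That r is odd under the symmetry tau
   replaces the condition of mean zero and survives truncation. *)
Record scheme (T : finType) (xi0 : T -> R) (rho S sg : R) := Scheme {
  sch_Om : finType;
  sch_K : finType;
  sch_I : finType;
  sch_xi : sch_K -> sch_Om -> R;
  sch_w : sch_I -> sch_Om -> R;
  sch_c : sch_K -> sch_I -> R;
  sch_s : sch_K -> sch_Om -> R;
  sch_r : sch_K -> sch_Om -> R;
  sch_tau : sch_Om -> sch_Om;
  sch_Om_gt0 : (0 < #|sch_Om|)%N;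
  sch_K_gt0 : (0 < #|sch_K|)%N;
  sch_card_I : #|sch_I|%:R <= rho * #|sch_K|%:R;
  sch_iid : forall phi : sch_K -> R -> R,
    avg (fun om => \prod_k phi k (sch_xi k om)) =
    \prod_k avg (fun t => phi k (xi0 t));
  sch_decomposition : forall k om, sch_xi k om =
    \sum_i sch_c k i * sch_w i om + sch_s k om + sch_r k om;
  sch_norm_s : forall k om, `|sch_s k om| <= S;
  sch_norm_r : forall k om, `|sch_r k om| <= 1;
  sch_var_r : forall k, avg (fun om => sch_r k om ^+ 2) <= sg;
  sch_tau_inj : injective sch_tau;
  sch_r_odd : forall k om, sch_r k (sch_tau om) = - sch_r k om }.

Lemma sum_pair_delta1 (A B : finType) (a : A) (F : B -> R) (G : A * B -> R) :
  \sum_p (if p.1 == a then F p.2 else 0) * G p = \sum_b F b * G (a, b).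
Proof.
transitivity (\sum_x \sum_y (if x == a then F y else 0) * G (x, y)).
  by rewrite pair_bigA; apply: eq_bigr => -[].
rewrite (bigD1 a) //= [X in _ + X]big1 ?addr0; last first.
  by move=> x /negbTE xa; rewrite big1 // => y _; rewrite xa mul0r.
by apply: eq_bigr => y _; rewrite eqxx.
Qed.

(** Start of the iteration: a single copy, no approximating function, and everything in the rest. *)
Lemma scheme0 (T : finType) (xi0 : T -> R) (tau : T -> T) :
  (0 < #|T|)%N -> (forall t, `|xi0 t| <= 1) -> injective tau ->
  (forall t, xi0 (tau t) = - xi0 t) ->
  scheme xi0 0 0 (avg (fun t => xi0 t ^+ 2)).
Proof.
move=> T0 xi1 tau_inj xi_odd.
apply: (@Scheme T xi0 0 0 _ T 'I_1 void (fun=> xi0) (fun _ _ => 0) (fun _ _ => 0)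
          (fun _ _ => 0) (fun=> xi0) tau) => //.
- by rewrite card_ord.
- by rewrite card_void mul0r.
- by move=> phi; rewrite big_ord1; apply: eq_avg => t; rewrite big_ord1.
- by move=> _ t; rewrite big1 ?add0r // => -[].
- by move=> _ _; rewrite normr0.
Qed.

Lemma scheme_le (T : finType) (xi0 : T -> R) (rho S sg rho' S' sg' : R) :
  rho <= rho' -> S <= S' -> sg <= sg' ->
  scheme xi0 rho S sg -> scheme xi0 rho' S' sg'.
Proof.
move=> rho_le S_le sg_le [Om K I xi w c s r tau Om0 K0 cI iid dec ns nr vr tau_inj odd].
apply: (@Scheme T xi0 rho' S' sg' Om K I xi w c s r tau) => //.
- by apply: le_trans cI _; rewrite ler_wpM2r.
- by move=> k om; apply: le_trans S_le.
- by move=> k; apply: le_trans sg_le.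
Qed.

(** Take [K1] independent copies of the scheme and, for each k in [K], reduce the [K1] copies of r_k
    together. The old functions keep their proportion rho; the #|K| #|J| new ones, against #|K1|
    #|K| = b #|J| #|K| functions to approximate, add 1/b. *)
Lemma scheme_step (T : finType) (xi0 : T -> R) (rho S sg : R)
    (b g : nat) (K1 J : finType) (X : K1 -> J -> R) (y tr : R) :
  flat_system b g X -> (0 < b)%N -> (0 < #|J|)%N -> 1 <= y ->
  2 * 2^-1 ^+ g * y ^+ 2 <= 1 -> 8 * b%:R * y ^+ 2 * sg <= 1 -> 0 < tr ->
  scheme xi0 rho S sg ->
  scheme xi0 (rho + b%:R^-1) (S + tr)
    (1024 / (tr * y ^+ 2) ^+ 2 + 2 * #|K1|%:R * expR (- (3 / 4 * y ^+ 2))).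
Proof.
move=> Xflat b0 J0 y1 yg ysg tr0.
move=> [Om K I xi w c s r tau Om0 K0 cI iid dec ns nr vr tau_inj odd].
have [cK1 _ _ _] := Xflat.
pose xi' (p : K1 * K) (om : {ffun K1 -> Om}) := xi p.2 (om p.1).
pose w' (i : K1 * I + K * J) (om : {ffun K1 -> Om}) := match i with
  | inl p => w p.2 (om p.1)
  | inr p => (cross_good (r p.1) X om)%:R * \sum_l X l p.2 * r p.1 (om l) end.
pose c' (q : K1 * K) (i : K1 * I + K * J) := match i with
  | inl p => if p.1 == q.1 then c q.2 p.2 else 0
  | inr p => if p.1 == q.2 then X q.1 p.2 else 0 end.
pose s' (q : K1 * K) (om : {ffun K1 -> Om}) :=
  s q.2 (om q.1) + new_tame (r q.2) X tr q.1 om.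
pose r' (q : K1 * K) := new_rest (r q.2) X tr q.1.
pose tau' (om : {ffun K1 -> Om}) := [ffun l => tau (om l)].
apply: (@Scheme T xi0 _ _ _ {ffun K1 -> Om} (K1 * K)%type (K1 * I + K * J)%type
  xi' w' c' s' r' tau').
- by rewrite card_ffun expn_gt0 Om0.
- by rewrite card_prod muln_gt0 K0 cK1 muln_gt0 b0 J0.
- rewrite card_sum !card_prod natrD !natrM mulrDl lerD //.
    by rewrite mulrCA ler_wpM2l.
  rewrite cK1 natrM mulrA mulrA mulVf ?mul1r 1?mulrC // pnatr_eq0 -lt0n //.
- move=> phi; transitivity (\prod_k \prod_l avg (fun t => phi (k, l) (xi0 t))); last first.
    by rewrite pair_bigA; apply: eq_bigr => -[].
  under [RHS]eq_bigr => k _ do rewrite -(iid (fun l => phi (k, l))).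
  rewrite -avg_prod; apply: eq_avg => om.
  by rewrite pair_bigA; apply: eq_bigr => -[].
- move=> [k l] om; rewrite /xi' /s' /r' /= dec big_sumType /= !sum_pair_delta1 /=.
  rewrite {1}(new_decomposition (r l) Xflat tr k om).
  by ring.
- move=> [k l] om; rewrite /s' /=; apply: le_trans (ler_normD _ _) _.
  by rewrite lerD // norm_new_tame.
- by move=> [k l] om; apply: norm_new_rest.
- move=> [k l]; exact: (avg_new_rest Om0 tau_inj (odd l) (nr l) (vr l) Xflat).
- move=> om om' e; apply/ffunP => k; apply: tau_inj.
  by have := congr1 (fun f : {ffun K1 -> Om} => f k) e; rewrite !ffunE.
- by move=> [k l] om; apply: new_rest_odd.
Qed.

End Scheme.

(** * Iteration of the step and choice of the parameters *)

Section Iteration.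
Context {R : realType}.

(** Compares exponents of 2 in the union bound: those of 2 #|K| and of the inverse of the allowed
    variance on the left, that of the Chernoff gain on the right. *)
Lemma exponent_bound (B n m0 m : nat) : (B + 5 <= m0)%N -> m = (m0 + 2 * n)%N ->
  (1 + (B + n + 2 * (2 ^ (B + n) * (2 * m + 1))) + (9 + B + 2 * m0 + 5 * n)
   <= 2 ^ (2 * m - 1))%N.
Proof.
move=> Bm0 mE; set P := (2 ^ (B + n))%N.
have P0 : (0 < P)%N by rewrite expn_gt0.
have m1 : (m + 1 <= 2 ^ m)%N by rewrite addn1 ltn_expl.
have mP : (16 * P <= 2 ^ (m - 1))%N.
  by rewrite /P (_ : 16 = 2 ^ 4)%N // -expnD leq_exp2l // ; lia.
have -> : (2 * m - 1 = (m - 1) + m)%N by lia.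
rewrite expnD; have := leq_mul mP m1; nia.
Qed.

(** Uses e >= 2 and 3/4 4^m >= 2^(2m - 1). *)
Lemma expR_le_half (m : nat) : (0 < m)%N ->
  expR (- (3 / 4 * (2 ^+ m) ^+ 2)) <= 2^-1 ^+ (2 ^ (2 * m - 1)) :> R.
Proof.
move=> m0; apply: (@le_trans _ _ (expR (- 1 * (2 ^ (2 * m - 1))%:R))).
  rewrite ler_expR mulN1r lerN2 natrX -exprM (mulnC m 2).
  have [k ->] : exists k, (2 * m = k.+1)%N by exists (2 * m - 1)%N; lia.
  have : 0 <= 2 ^+ k :> R by rewrite exprn_ge0.
  by rewrite subn1 exprS /=; lra.
rewrite expRM_natr lerXn2r ?nnegrE ?expR_ge0 ?invr_ge0 //.
by rewrite expRN lef_pV2 ?posrE ?expR_gt0 //; have := expR_ge1Dx (1 : R); lra.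
Qed.

Section Steps.
Variables (T : finType) (xi0 : T -> R) (tau : T -> T) (B m0 : nat) (T0 : R).
Hypothesis T_gt0 : (0 < #|T|)%N.
Hypothesis xi0_le1 : forall t, `|xi0 t| <= 1.
Hypothesis tau_inj : injective tau.
Hypothesis xi0_odd : forall t, xi0 (tau t) = - xi0 t.
Hypothesis T0_gt0 : 0 < T0.
Hypothesis xi0_var : avg (fun t => xi0 t ^+ 2) <= 2^-1 ^+ (3 + B + 2 * m0).
Hypothesis T0_m0 : 2 ^+ (19 + B) <= T0 ^+ 2 * 4 ^+ m0.
Hypothesis B_m0 : (B + 5 <= m0)%N.

(* The n-th step uses 2^(B+n) bases and the truncation level T0/2^n. *)
Lemma scheme_iterate (n : nat) :
  scheme xi0 (2 * 2^-1 ^+ B * (1 - 2^-1 ^+ n)) (2 * T0 * (1 - 2^-1 ^+ n))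
    (2^-1 ^+ (3 + B + 2 * m0 + 5 * n)).
Proof.
elim: n => [|n IH].
  apply: scheme_le (scheme0 T_gt0 xi0_le1 tau_inj xi0_odd).
  - by rewrite expr0 subrr mulr0.
  - by rewrite expr0 subrr mulr0.
  - by rewrite muln0 addn0.
(* With y = 2^m, both conditions that tie y to g, b and the variance become equalities. *)
pose m := (m0 + 2 * n)%N; pose g := (2 * m + 1)%N; pose b := (2 ^ (B + n))%N.
pose y : R := 2 ^+ m; pose tr := T0 * 2^-1 ^+ n.
have h2 : 2^-1 * 2 = 1 :> R by rewrite mulVf.
have y2 : y ^+ 2 = 2 ^+ (2 * m) by rewrite /y -exprM mulnC.
have b2 : b%:R = 2 ^+ (B + n) :> R by rewrite natrX.
apply: scheme_le (scheme_step (flat_tensor_row b g) (y := y) (tr := tr) _ _ _ _ _ _ IH).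
- rewrite b2 -exprVn exprD exprS le_eqVlt; apply/orP; left; apply/eqP.
  by field.
- rewrite /tr exprS le_eqVlt; apply/orP; left; apply/eqP; by field.
(* The allowed variance is split into two halves 2^-N: one for the fourth moment, one for the union
   bound. *)
- have -> : (3 + B + 2 * m0 + 5 * n.+1 = (9 + B + 2 * m0 + 5 * n).-1)%N by lia.
  set N := (9 + B + 2 * m0 + 5 * n)%N.
  have N0 : (0 < N)%N by rewrite /N.
  have -> : 2^-1 ^+ N.-1 = 2^-1 ^+ N + 2^-1 ^+ N :> R.
    by rewrite -[in RHS](prednK N0) exprS; field.
  apply: lerD.
    have T00 : 0 < (tr * y ^+ 2) ^+ 2.
      by rewrite exprn_gt0 // mulr_gt0 ?mulr_gt0 ?exprn_gt0 // invr_gt0.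
    rewrite ler_pdivrMr // exprVn mulrC ler_pdivlMr ?exprn_gt0 //.
    have -> : (tr * y ^+ 2) ^+ 2 = (T0 ^+ 2 * 4 ^+ m0) * 2 ^+ (2 * m0 + 6 * n).
      rewrite /tr y2 !exprMn -!exprM exprVn.
      have -> : 4 ^+ m0 = 2 ^+ (2 * m0) :> R by rewrite exprM -(natrX _ 2 2).
      move: (T0 ^+ 2) => z; rewrite -!mulrA -exprD; congr (_ * _).
      apply: (@mulfI _ (2 ^+ (n * 2))); first by rewrite expf_neq0.
      rewrite mulrA mulfV ?expf_neq0 // mul1r -exprD; congr (_ ^+ _); rewrite /m; lia.
    apply: (@le_trans _ _ (2 ^+ (19 + B) * 2 ^+ (2 * m0 + 6 * n))); last first.
      by rewrite ler_wpM2r // exprn_ge0.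
    have -> : 1024 = 2 ^+ 10 :> R by rewrite -(natrX _ 2 10).
    rewrite -!exprD ler_eXn2l ?ltr1n // /N; lia.
  have m_gt0 : (0 < m)%N by rewrite /m; lia.
  have cK : 2 * #|{: 'I_b * {ffun 'I_b * 'I_g -> 'I_4}}|%:R =
      2 ^+ (1 + (B + n + 2 * (b * g))) :> R.
    rewrite card_prod card_ffun card_prod !card_ord natrM b2 natrX.
    have -> : 4 = 2 ^+ 2 :> R by rewrite -(natrX _ 2 2).
    by rewrite -exprM -exprD -exprS.
  rewrite cK exprVn -[leRHS]mul1r ler_pdivlMr ?exprn_gt0 // mulrAC -exprD.
  apply: le_trans (ler_wpM2l _ (expR_le_half m_gt0)) _; first exact: exprn_ge0.
  rewrite exprVn ler_pdivrMr ?exprn_gt0 // mul1r ler_eXn2l ?ltr1n //.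
  exact: exponent_bound.
- by rewrite expn_gt0.
- by rewrite card_ffun expn_gt0 card_ord.
- by rewrite exprn_ege1 // ler1n.
- have p0 : 2 ^+ (2 * m) != 0 :> R by rewrite expf_neq0.
  rewrite y2 /g exprD expr1 exprVn; move: p0; set p := 2 ^+ _ => p0.
  by rewrite (_ : 2 * (p^-1 / 2) * p = 1) //; field.
- rewrite y2 b2 exprVn ler_pdivrMr ?exprn_gt0 // mul1r.
  have -> : 8 = 2 ^+ 3 :> R by rewrite -(natrX _ 2 3).
  rewrite -!exprD ler_eXn2l ?ltr1n // /m; lia.
- by rewrite mulr_gt0 ?exprn_gt0 // invr_gt0.
Qed.

End Steps.

Lemma exists_half_lt (e : R) : 0 < e -> exists n, forall N, (n <= N)%N -> 2^-1 ^+ N <= e.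
Proof.
move=> e0; exists (Num.bound e^-1) => N nN.
rewrite exprVn invf_ple ?posrE ?exprn_gt0 //.
have e1 : 0 <= e^-1 by rewrite invr_ge0 ltW.
apply: le_trans (ltW (archi_boundP e1)) _.
by rewrite -natrX ler_nat (leq_trans nN) // ltnW // ltn_expl.
Qed.

(** A smaller [sg] only costs more steps: the proportions and the truncation levels add up to
    geometric series, bounded whatever the number of steps. Hence [C] and [d] depend on [rho]
    alone. *)
Lemma scheme_exists (rho : R) : 0 < rho ->
  exists C d : R, [/\ 0 < C, 0 < d &
    forall (T : finType) (xi0 : T -> R) (tau : T -> T) (S sg : R),
      (0 < #|T|)%N -> (forall t, `|xi0 t| <= 1) -> injective tau ->
      (forall t, xi0 (tau t) = - xi0 t) -> 0 < S -> S <= d -> 0 < sg ->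
      C * avg (fun t => xi0 t ^+ 2) <= S ^+ 2 ->
      inhabited (scheme xi0 rho S sg)].
Proof.
move=> rho0.
have [B HB] := @exists_half_lt (rho / 2) (divr_gt0 rho0 (ltr0n _ 2)).
exists (2 ^+ (26 + 2 * B)), (2^-1 ^+ B); split; rewrite ?exprn_gt0 ?invr_gt0 //.
move=> T xi0 tau S sg T_gt0 xi1 tau_inj odd S0 Sd sg0 var.
(* The levels T0/2^n sum to at most 2 T0 = S. *)
pose T0 := S / 2.
have T00 : 0 < T0 by rewrite divr_gt0.
have T02 : 0 < T0 ^+ 2 by rewrite exprn_gt0.
have ex : exists m, 2 ^+ (19 + B) <= T0 ^+ 2 * 4 ^+ m.
  have [m Hm] := @exists_half_lt (T0 ^+ 2 / 2 ^+ (19 + B)) (divr_gt0 T02 (exprn_gt0 _ (ltr0n _ 2))).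
  exists m; have := Hm (2 * m)%N (leq_pmull m (ltn0Sn 1)).
  rewrite ler_pdivlMr ?exprn_gt0 // exprVn mulrC ler_pdivrMr ?exprn_gt0 //.
  by rewrite exprM -(natrX _ 2 2).
(* Minimality bounds T0^2 4^(m0 - 1) from above, which turns the hypothesis on the variance into the
   one of the iteration; S <= d makes m0 large. *)
case: (ex_minnP ex) => m0 Hm0 min_m0.
have E4 k : 4 ^+ k = 2 ^+ (2 * k) :> R by rewrite exprM -(natrX _ 2 2).
have Bm0 : (B + 5 <= m0)%N.
  have h : T0 ^+ 2 <= 2^-1 ^+ (2 * B).
    rewrite mulnC exprM lerXn2r ?nnegrE ?exprn_ge0 ?invr_ge0 ?(ltW T00) //.
    by apply: le_trans Sd; rewrite /T0; lra.
  have : 2 ^+ (19 + B) <= 2^-1 ^+ (2 * B) * 4 ^+ m0 :> R.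
    by apply: le_trans Hm0 _; rewrite ler_wpM2r // exprn_ge0.
  rewrite exprVn mulrC ler_pdivlMr ?exprn_gt0 // -exprD E4 ler_eXn2l ?ltr1n //; lia.
have var0 : avg (fun t => xi0 t ^+ 2) <= 2^-1 ^+ (3 + B + 2 * m0).
  case: m0 Bm0 Hm0 min_m0 => [|m] Bm0 Hm0 min_m0; first by lia.
  have hm : T0 ^+ 2 * 4 ^+ m <= 2 ^+ (19 + B).
    by rewrite leNgt; apply/negP => /ltW /min_m0; rewrite ltnn.
  rewrite -(ler_pM2l (exprn_gt0 (26 + 2 * B) (ltr0n R 2))).
  apply: le_trans var _; rewrite exprVn ler_pdivlMr ?exprn_gt0 //.
  have -> : S ^+ 2 * 2 ^+ (3 + B + 2 * m.+1) = (T0 ^+ 2 * 4 ^+ m) * 2 ^+ (7 + B).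
    have -> : S ^+ 2 = T0 ^+ 2 * 2 ^+ 2 by rewrite /T0; field.
    rewrite E4; move: (T0 ^+ 2) => z.
    by rewrite -!(mulrA z) -!exprD; congr (_ * _); congr (_ ^+ _); lia.
  apply: le_trans (ler_wpM2r _ hm) _; first exact: exprn_ge0.
  by rewrite -exprD ler_eXn2l ?ltr1n //; lia.
have [n Hn] := exists_half_lt sg0.
have := scheme_iterate T_gt0 xi1 tau_inj odd T00 var0 Hm0 Bm0 n.
have n0 : 0 <= 2^-1 ^+ n :> R by rewrite exprn_ge0 // invr_ge0.
move=> sch; constructor; apply: scheme_le sch.
- have hB := HB B (leqnn B); have B0 : 0 <= 2^-1 ^+ B :> R by rewrite exprn_ge0 // invr_ge0.
  by move: hB B0 n0; set p := _ ^+ B; set q := _ ^+ n => *; nra.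
- by rewrite /T0; move: n0; set q := _ ^+ n => *; nra.
- by apply: Hn; lia.
Qed.

End Iteration.

(** * Finite probability spaces realized on the unit interval *)

Section Sample.
Context d {T : measurableType d} {R : realType}.
Variables (mu : {measure set T -> \bar R}) (D : set T) (Om : finType).
Variable sample : T -> Om.
Hypothesis sample_meas : forall om, measurable (D `&` sample @^-1` [set om]).
Hypothesis sample_unif : forall om,
  mu (D `&` sample @^-1` [set om]) = (#|Om|%:R^-1)%:E.

Lemma measurable_preimage_sample (P : set Om) : measurable (D `&` sample @^-1` P).
Proof.
have -> : D `&` sample @^-1` P = \bigcup_(om in P) (D `&` sample @^-1` [set om]).
  rewrite -setI_bigcupr; congr (_ `&` _); apply/seteqP; split => t /=.
    by move=> Pt; exists (sample t).
  by move=> [om Pom /= ->].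
by apply: fin_bigcup_measurable => // om _; exact: sample_meas.
Qed.

Lemma ge0_integral_sample (F : Om -> R) : (forall om, 0 <= F om) ->
  (\int[mu]_(t in D) (F (sample t))%:E = (avg F)%:E)%E.
Proof.
move=> F0; pose C om := D `&` sample @^-1` [set om].
have DE : D = \big[setU/set0]_(om <- index_enum Om) C om.
  rewrite -bigcup_seq /C -setI_bigcupr; apply/seteqP; split => [t Dt|t []//].
  by split => //; exists (sample t) => //=; exact: mem_index_enum.
rewrite {1}DE ge0_integral_bigsetU //=; last 4 first.
- exact: index_enum_uniq.
- by move=> om om' _ _ [t [[_ /= <-] [_ /= <-]]].
- rewrite -DE => _ Y _.
  exact: (measurable_preimage_sample (fun om => Y (F om)%:E)).
- by move=> t _; rewrite lee_fin.
rewrite /avg mulr_suml -sumEFin; apply: eq_bigr => om _.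
rewrite (@eq_integral _ _ _ _ (C om) (cst (F om)%:E)) => [|t /set_mem[_ /= ->]//].
by rewrite integral_cst; [rewrite sample_unif|exact: sample_meas].
Qed.

Lemma integral_sample (F : Om -> R) :
  (\int[mu]_(t in D) (F (sample t))%:E = (avg F)%:E)%E.
Proof.
rewrite integralE.
under eq_integral do rewrite funeposE -EFin_max.
rewrite (ge0_integral_sample (F := fun om => Num.max (F om) 0)) => [|om]; last first.
  by rewrite le_max lexx orbT.
under eq_integral do rewrite funenegE -EFinN -EFin_max.
rewrite (ge0_integral_sample (F := fun om => Num.max (- F om) 0)) => [|om]; last first.
  by rewrite le_max lexx orbT.
rewrite -EFinB -mulrBl -sumrB; congr ((_ / _)%:E); apply: eq_bigr => om _.
by case: (leP (F om) 0) => h; case: (leP (- F om) 0) => h'; lra.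
Qed.

Lemma measure_sample (P : pred Om) :
  mu (D `&` sample @^-1` [set` P]) = (avg (fun om => (P om)%:R))%:E.
Proof.
have mD : measurable D.
  by rewrite -[D]setIT -(preimage_setT sample); exact: measurable_preimage_sample.
rewrite -integral_sample -[in LHS](setIidr (@subIsetl _ D _)) setIC.
rewrite -integral_indic //; last exact: measurable_preimage_sample.
apply: eq_integral => t /set_mem Dt; rewrite indicE; congr (_%:R%:E).
case: (boolP (P (sample t))) => Pt; first by rewrite mem_set.
by rewrite memNset // => -[_ /= Pt']; move: Pt'; rewrite unfold_in (negbTE Pt).
Qed.

End Sample.

Section SampleExists.
Context {R : realType}.
Local Notation leb := (@completed_lebesgue_measure R).

Lemma measurable_lebesgueR_itv (i : interval R) :
  measurable ([set` i] : set (lebesgueR R)).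
Proof. exact: sub_caratheodory (measurable_itv i). Qed.

Lemma completed_lebesgue_measure_itv (i : interval R) :
  leb ([set` i] : set (lebesgueR R)) =
  (if i.1 < i.2 then (i.2 : \bar R) - i.1 else 0)%E.
Proof. exact: lebesgue_measure_itv. Qed.

(** The minimum matters at t = 1, which would otherwise get the index N; hence the last cell is
    closed and the others are half-open. *)
Lemma minn_truncn_eq (N i : nat) (t : R) : (i < N)%N ->
  (t \in `[0, 1]) && (minn (Num.truncn (t * N%:R)) N.-1 == i) =
  (t \in Interval (BLeft (i%:R / N%:R)) (BSide (i.+1 != N) (i.+1%:R / N%:R))).
Proof.
move=> iN; have N0 : 0 < N%:R :> R by rewrite ltr0n; lia.
have iN' : i.+1%:R <= N%:R :> R by rewrite ler_nat.
have Nn0 : N%:R != 0 :> R by rewrite gt_eqF.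
have i0 : 0 <= i%:R :> R by [].
rewrite !in_itv /= ler_pdivrMr //.
have minE k : (minn k N.-1 == i) = if i.+1 == N then (i <= k)%N else k == i.
  by rewrite /minn; case: ltnP => kN; case: (i.+1 =P N) => iNE;
    apply/eqP/idP => [|/eqP]; rewrite ?eqxx //; lia.
rewrite minE; have [iNE|iNE] := eqVneq i.+1 N.
  rewrite /= iNE mulfV //; apply/idP/idP => [/andP[/andP[t0 ->]]|/andP[it t1]].
    by rewrite andbT truncn_ge_nat // mulr_ge0.
  have t0 : 0 <= t by rewrite -(pmulr_lge0 _ N0) (le_trans i0).
  by rewrite t0 t1 truncn_ge_nat ?mulr_ge0.
rewrite /= ltr_pdivlMr //; apply/idP/idP => [/andP[/andP[t0 t1]]|/andP[it ti]].
  by rewrite truncn_eq // mulr_ge0.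
have t0 : 0 <= t by rewrite -(pmulr_lge0 _ N0) (le_trans i0).
have t1 : t <= 1 by rewrite -(ler_pM2r N0) mul1r (le_trans (ltW ti)).
by rewrite t0 t1 truncn_eq ?mulr_ge0 // it.
Qed.

Lemma sample_exists (Om : finType) : (0 < #|Om|)%N ->
  exists sample : lebesgueR R -> Om, forall om,
    measurable (@unit_itv R `&` sample @^-1` [set om]) /\
    leb (@unit_itv R `&` sample @^-1` [set om]) = (#|Om|%:R^-1)%:E.
Proof.
move=> Om0; set N := #|Om|.
have idx_lt (t : R) : (minn (Num.truncn (t * N%:R)) N.-1 < N)%N by lia.
pose sample (t : lebesgueR R) : Om := enum_val (Ordinal (idx_lt t)).
exists sample => om.
pose i := enum_rank om.
have -> : @unit_itv R `&` sample @^-1` [set om] = [set` Interval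
    (BLeft (i%:R / N%:R)) (BSide (i.+1 != N) (i.+1%:R / N%:R))].
  apply/seteqP; split => t /=.
    move=> [t01 st]; rewrite -minn_truncn_eq // t01 /=.
    by rewrite /i -st /sample enum_valK.
  rewrite -minn_truncn_eq // => /andP[t01 /eqP ti]; split => //.
  by rewrite /sample -[RHS]enum_rankK; congr enum_val; apply: val_inj.
split; first exact: measurable_lebesgueR_itv.
rewrite completed_lebesgue_measure_itv /= lte_fin.
have N0 : 0 < N%:R :> R by rewrite ltr0n.
by rewrite ltr_pM2r ?invr_gt0 // ltr_nat ltnSn -EFinB -mulrBl -natrB // subSnn mul1r.
Qed.

End SampleExists.

(** * Inequalities for Orlicz functions *)

Section OrliczFunction.
Context {R : realType} (Phi : R -> R).
Hypothesis hPhi : orlicz_function Phi.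

Let nneg_itv (u : R) : 0 <= u -> u \in `[0, +oo[.
Proof. by move=> u0; rewrite in_itv /= u0. Qed.

Lemma orlicz_function_ge0 (u : R) : 0 <= u -> 0 <= Phi u.
Proof. by move=> u0; apply: (orlicz_ge0 hPhi); exact: nneg_itv. Qed.

Lemma orlicz_function_lt (u v : R) : 0 <= u -> u < v -> Phi u < Phi v.
Proof.
move=> u0 uv; apply: (orlicz_increasing hPhi) => //; apply: nneg_itv => //.
by rewrite (le_trans u0) // ltW.
Qed.

Lemma orlicz_function_le (u v : R) : 0 <= u -> u <= v -> Phi u <= Phi v.
Proof.
move=> u0; rewrite le_eqVlt => /orP[/eqP->//|uv].
by rewrite ltW // orlicz_function_lt.
Qed.

Lemma orlicz_function_conv (p u v : R) : 0 <= p -> p <= 1 -> 0 <= u -> 0 <= v ->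
  Phi (p * u + (1 - p) * v) <= p * Phi u + (1 - p) * Phi v.
Proof.
move=> p0 p1 u0 v0.
have := orlicz_convex hPhi (@Itv01 R p p0 p1) (mem_set (nneg_itv u0)) (mem_set (nneg_itv v0)).
by rewrite !convRE.
Qed.

Lemma orlicz_function_scale (p u : R) : 0 <= p -> p <= 1 -> 0 <= u ->
  Phi (p * u) <= p * Phi u.
Proof.
move=> p0 p1 u0; have := orlicz_function_conv p0 p1 u0 (lexx 0).
by rewrite mulr0 addr0 (orlicz0 hPhi) mulr0 addr0.
Qed.

(* Convexity splits the two parts of the error: the first is absorbed by
   Phi 1 = 1, the second is bounded by its L1 norm. *)
Lemma orlicz_function_split (u l S s r : R) : 0 <= u -> 0 < l ->
  2 * u * S <= l -> `|s| <= S -> `|r| <= 1 ->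
  Phi (`|u * (s + r)| / l) <= 2^-1 + 2^-1 * (`|r| * Phi (2 * u / l)).
Proof.
move=> u0 l0 uS sS r1.
have S0 : 0 <= S by apply: le_trans sS.
have ul0 : 0 <= 2 * u / l by rewrite divr_ge0 ?mulr_ge0 // ltW.
have h : `|u * (s + r)| / l <= 2^-1 * 1 + (1 - 2^-1) * (`|r| * (2 * u / l)).
  rewrite ler_pdivrMr // normrM (ger0_norm u0).
  have := ler_wpM2l u0 (ler_normD s r); have := ler_wpM2l u0 sS.
  have -> : (2^-1 * 1 + (1 - 2^-1) * (`|r| * (2 * u / l))) * l = l / 2 + u * `|r|.
    by field; rewrite gt_eqF.
  by move=> *; lra.
apply: le_trans (orlicz_function_le _ h) _; first by rewrite divr_ge0 // ltW.
apply: le_trans (orlicz_function_conv _ _ _ _) _; rewrite ?mulr_ge0 //;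
  [by lra|by rewrite invr_ge0 ltW|].
rewrite (orlicz1 hPhi) mulr1 lerD2l (_ : 1 - 2^-1 = 2^-1); last by lra.
by rewrite ler_wpM2l // orlicz_function_scale.
Qed.

End OrliczFunction.

Section LimfEsup.
Context {R : realType}.

Lemma limf_esup_pinfty_gt (f : R -> R) (U M : R) :
  limf_esup (fun u => (f u)%:E) +oo%R = +oo%E -> exists2 u, U < u & M < f u.
Proof.
move=> fy.
have : (M%:E < ereal_sup [set (f u)%:E | u in [set u | (U < u)%R]])%E.
  apply: lt_le_trans (ltry M) _; rewrite -fy; apply: ereal_inf_lbound.
  exists [set u | U < u] => //; exists U; split => //; exact: num_real.
by move=> /ereal_sup_gt[_ [u Uu <-]]; rewrite lte_fin; exists u.
Qed.

End LimfEsup.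

(** * The symmetric three-valued variable *)

Section Ternary.
Context {R : realType} (q : nat).
Hypothesis q_gt0 : (0 < q)%N.

Definition ternary (t : 'I_q * bool) : R :=
  if t.1 == 0%N :> nat then (-1) ^+ t.2 else 0.

Lemma norm_ternary_le1 t : `|ternary t| <= 1.
Proof. by rewrite /ternary; case: ifP; rewrite ?normr0 // normr_sign. Qed.

Lemma ternary_odd t : ternary (t.1, ~~ t.2) = - ternary t.
Proof. by rewrite /ternary; case: ifP => /=; rewrite ?oppr0 // signrN. Qed.

Lemma ternary_flip_inj : injective (fun t : 'I_q * bool => (t.1, ~~ t.2)).
Proof. by move=> [i a] [j b] [-> /negb_inj ->]. Qed.

Lemma avg_ternary (phi : R -> R) : phi 0 = 0 -> phi (-1) = phi 1 ->
  avg (fun t => phi (ternary t)) = phi 1 / q%:R.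
Proof.
move=> phi0 phiN.
have -> : avg (fun t => phi (ternary t)) =
    (\sum_i \sum_s phi (ternary (i, s))) / #|{: 'I_q * bool}|%:R.
  by rewrite /avg pair_bigA; congr (_ / _); apply: eq_bigr => -[].
rewrite (bigD1 (Ordinal q_gt0)) //= [X in _ + X]big1; last first.
  by move=> i i0; rewrite big1 // => s _; rewrite /ternary ifN.
rewrite big_bool /ternary /= expr1 expr0 phiN addr0 card_prod card_ord card_bool.
by rewrite natrM; field; rewrite pnatr_eq0 -lt0n.
Qed.

End Ternary.

(** * Norms and widths of functions of a sample *)

Section Transfer.
Context {R : realType} (Phi : R -> R).
Hypothesis hPhi : orlicz_function Phi.
Local Notation leb := (@completed_lebesgue_measure R).
Variables (Om : finType) (sample : lebesgueR R -> Om).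
Hypothesis Om_gt0 : (0 < #|Om|)%N.
Hypothesis sample_meas : forall om, measurable (@unit_itv R `&` sample @^-1` [set om]).
Hypothesis sample_unif : forall om,
  leb (@unit_itv R `&` sample @^-1` [set om]) = (#|Om|%:R^-1)%:E.

Lemma integral_orlicz_sample (F : Om -> R) (l : R) :
  (\int[leb]_(t in @unit_itv R) (Phi (`|F (sample t)| / l))%:E =
   (avg (fun om => Phi (`|F om| / l)))%:E)%E.
Proof. exact: (integral_sample sample_meas sample_unif (fun om => Phi (`|F om| / l))). Qed.

Lemma luxemburg_norm_sample_le (F : Om -> R) (l : R) : 0 < l ->
  avg (fun om => Phi (`|F om| / l)) <= 1 ->
  (luxemburg_norm Phi (fun t => F (sample t)) <= l%:E)%E.
Proof.
move=> l0 Fl; apply: ereal_inf_lbound; exists l => //; split => //.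
by rewrite integral_orlicz_sample lee_fin.
Qed.

Lemma luxemburg_norm_sample_ge1 (F : Om -> R) :
  (forall l, 0 < l -> l < 1 -> 1 < avg (fun om => Phi (`|F om| / l))) ->
  (1 <= luxemburg_norm Phi (fun t => F (sample t)))%E.
Proof.
move=> Fl; apply: le_ereal_inf_tmp => _ [l [l0 +] <-].
rewrite integral_orlicz_sample !lee_fin; apply: contraTT.
by rewrite -!ltNge; exact: Fl.
Qed.

Lemma orlicz_space_sample (F : Om -> R) : orlicz_space Phi (fun t => F (sample t)).
Proof.
split; first by move=> _ Y _; exact: (measurable_preimage_sample sample_meas (F @^-1` Y)).
pose M := 1 + \sum_om `|F om|.
have S0 : 0 <= \sum_om `|F om| by exact: sumr_ge0.
have M0 : 0 < M by rewrite /M; lra.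
apply: le_lt_trans (luxemburg_norm_sample_le (l := M) M0 _) (ltry _).
rewrite -[leRHS](avg_cst 1 Om_gt0); apply: ler_avg => om.
rewrite -(orlicz1 hPhi) orlicz_function_le // ?divr_ge0 ?(ltW M0) //.
rewrite ler_pdivrMr // mul1r /M (bigD1 om) //= addrCA lerDl addr_ge0 //.
exact: sumr_ge0.
Qed.

Lemma width_sample_le (I : finType) (w : I -> Om -> R) (n : nat) (l : R)
    (K : set (lebesgueR R -> R)) : (#|I| <= n)%N ->
  (forall x, K x -> exists c : I -> R, (luxemburg_norm Phi
     (fun t => (x t - \sum_i c i * w i (sample t))%R) <= l%:E)%E) ->
  (kolmogorov_width (orlicz_space Phi) (luxemburg_norm Phi) n K <= l%:E)%E.
Proof.
move=> In Kw.
pose V : set (lebesgueR R -> R) :=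
  [set v | exists c : I -> R, v = fun t => \sum_i c i * w i (sample t)].
have wV i : V (fun t => w i (sample t)).
  exists (fun j => (j == i)%:R); apply/funext => t.
  rewrite (bigD1 i) //= eqxx mul1r big1 ?addr0 // => j /negbTE ->.
  by rewrite mul0r.
have V0 : V (fun=> 0).
  by exists (fun=> 0); apply/funext => t; rewrite big1 // => i _; rewrite mul0r.
have Vlin : linear_subspace (orlicz_space Phi) V.
  split => //.
    by move=> _ [c ->]; exact: (orlicz_space_sample (fun om => \sum_i c i * w i om)).
  move=> a _ _ [c ->] [c' ->]; exists (fun i => a * c i + c' i); apply/funext => t.
  rewrite mulr_sumr -big_split; apply: eq_bigr => i _ /=.
  by rewrite mulrDl mulrA.
have Vdim : dim_le V n.
  (* The first #|I| indices enumerate [I]; the others, present when n is larger, carry the zero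
     function. *)
  pose e (j : 'I_n) : option I := omap (fun k : 'I_#|I| => enum_val k) (insub (val j)).
  exists (fun j => if e j is Some i then fun t => w i (sample t) else fun=> 0); split.
    by move=> j; case: (e j) => // ?; exact: wV.
  move=> _ [c ->]; exists (fun j => if e j is Some i then c i else 0).
  apply: aeW => t _; pose G i := c i * w i (sample t).
  pose H k := oapp (fun k : 'I_#|I| => G (enum_val k)) 0 (insub k).
  transitivity (\sum_(k < #|I|) H k).
    rewrite (eq_bigr (fun k => G (enum_val k))) => [|k _]; last by rewrite /H valK.
    by rewrite -big_enum_val.
  rewrite (big_ord_widen n H In) big_mkcond; apply: eq_bigr => j _.
  rewrite /H /e; case: insubP => [k -> _|/negbTE ->] //=.
  by rewrite mul0r.
apply: (@le_trans _ _
  (ereal_sup [set ereal_inf [set luxemburg_norm Phi (x \- v) | v in V] | x in K])).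
  by apply: ereal_inf_lbound; exists V.
apply: ge_ereal_sup => _ [x Kx <-]; have [c xc] := Kw x Kx.
apply: le_trans xc; apply: ereal_inf_lbound.
by exists (fun t => \sum_i c i * w i (sample t)) => //; exists c.
Qed.

End Transfer.

(** * From the product formula to independence on the unit interval *)

Section Independence.
Context {R : realType}.
Variables (T Om K : finType) (xi0 : T -> R) (xi : K -> Om -> R).
Hypothesis T_gt0 : (0 < #|T|)%N.
Hypothesis iid : forall phi : K -> R -> R,
  avg (fun om => \prod_k phi k (xi k om)) = \prod_k avg (fun t => phi k (xi0 t)).

(** The product formula with the test function 1 at every index but k. *)
Lemma avg_marginal (k : K) (phi : R -> R) :
  avg (fun om => phi (xi k om)) = avg (fun t => phi (xi0 t)).
Proof.
have := iid (fun l x => if l == k then phi x else 1).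
rewrite (bigD1 k) //= eqxx [X in _ * X]big1 ?mulr1 => [<-|l /negbTE ->]; last first.
  exact: avg_cst.
by apply: eq_avg => om; rewrite (bigD1 k) //= eqxx big1 ?mulr1 // => l /negbTE ->.
Qed.

Variable sample : lebesgueR R -> Om.
Hypothesis sample_meas : forall om, measurable (@unit_itv R `&` sample @^-1` [set om]).
Hypothesis sample_unif : forall om, completed_lebesgue_measure
  (@unit_itv R `&` sample @^-1` [set om]) = (#|Om|%:R^-1)%:E.

(** The product formula with the indicators of the sets [B k], rescaled by u. *)
Lemma independent_sample (u : R) :
  independent01 (fun (k : 'I_#|K|) t => u * xi (enum_val k) (sample t)).
Proof.
move=> B mB.
pose phi k x : R := (`[< B (enum_rank k) (u * x) >])%:R.
pose Q k om := `[< B k (u * xi (enum_val k) om) >].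
pose P om := [forall k, Q k om].
have -> : @unit_itv R `&` \bigcap_(k in [set: 'I_#|K|])
    ((fun t => u * xi (enum_val k) (sample t)) @^-1` B k) =
    @unit_itv R `&` sample @^-1` [set` P].
  congr (_ `&` _); apply/seteqP; split => t /= Bt.
    by apply/forallP => k; apply/asboolP; exact: Bt.
  by move=> k _; move/forallP: Bt => /(_ k) /asboolP.
rewrite (measure_sample sample_meas sample_unif).
rewrite [RHS](eq_bigr (fun k => (avg (fun om => (Q k om)%:R))%:E)) => [|k _]; last first.
  rewrite -(measure_sample sample_meas sample_unif (Q k)) /=; congr completed_lebesgue_measure.
  by congr (_ `&` _); apply/seteqP; split => t /asboolP.
rewrite -(big_morph EFin EFinM (erefl 1%:E)); congr _%:E.
transitivity (avg (fun om => \prod_k phi k (xi k om))).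
  apply: eq_avg => om; rewrite /P; case: forallP => [h|h].
    rewrite big1 // => k _; rewrite /phi.
    by have := h (enum_rank k); rewrite /Q enum_rankK => ->.
  have [k hk] : exists k, ~~ Q k om.
    by apply/existsP; rewrite -negb_forall; apply/negP => /forallP.
  by rewrite (bigD1 (enum_val k)) //= /phi enum_valK -/(Q k om) (negbTE hk) mul0r.
rewrite iid big_enum_val; apply: eq_bigr => k _.
by rewrite /phi enum_valK -(avg_marginal (enum_val k) (fun x => (`[< B k (u * x) >])%:R)).
Qed.

End Independence.

Theorem corollary3p16 (R : realType) (Phi : R -> R) :
  orlicz_function Phi ->
  limf_esup (fun u : R => (Phi u / u ^+ 2)%:E) +oo%R = +oo%E ->
  ~ property_IR (orlicz_space Phi) (luxemburg_norm Phi).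
Proof.
move=> hPhi lim [gamma g0 IR].
have [C [d [C0 d0 sch]]] := scheme_exists g0.
have [l l0 lg] : exists2 l, 0 < l & l < gamma by exists (gamma / 2); lra.
(* u > 1 gives q >= 1, u > l/(2d) gives S <= d, and Phi u > 8 C u^2/l^2 with Phi u <= 2q gives C/q
   <= S^2. *)
have [u Uu Mu] := limf_esup_pinfty_gt (Num.max 1 (l / (2 * d))) (8 * C / l ^+ 2) lim.
have [u1 ud] : 1 < u /\ l / (2 * d) < u by move: Uu; rewrite gt_max => /andP[].
have u0 : 0 < u by lra.
have Phi1 : 1 <= Phi u.
  by rewrite -(orlicz1 hPhi) orlicz_function_le // ltW.
pose q := Num.truncn (Phi u).
have q0 : (0 < q)%N by rewrite truncn_gt0.
have q1 : 1 <= q%:R :> R by rewrite ler1n.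
have [qPhi Phiq] : q%:R <= Phi u /\ Phi u <= 2 * q%:R.
  have /truncn_itv : 0 <= Phi u by lra.
  by rewrite -/q -natr1 => /andP[? ?]; split => //; lra.
(* The largest bound that [orlicz_function_split] allows: 2uS = l. *)
pose S := l / (2 * u); have S0 : 0 < S by rewrite divr_gt0 ?mulr_gt0.
have Sd : S <= d.
  rewrite ler_pdivrMr ?mulr_gt0 //; move: ud; rewrite ltr_pdivrMr ?mulr_gt0 //.
  by lra.
pose P := Phi (2 * u / l).
(* This depends on u through P, which is legitimate since [C] and [d] were fixed before [sg]. *)
pose sg := (1 + P ^+ 2)^-1.
have P20 : 0 < 1 + P ^+ 2 by have := sqr_ge0 P; lra.
have sg0 : 0 < sg by rewrite invr_gt0.
have var : C * avg (fun t => @ternary R q t ^+ 2) <= S ^+ 2.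
  rewrite (avg_ternary q0 (phi := fun x => x ^+ 2)) ?expr0n ?sqrrN // expr1n mul1r.
  rewrite ler_pdivrMr; last by lra.
  rewrite /S expr_div_n exprMn mulrAC ler_pdivlMr ?mulr_gt0 ?exprn_gt0 //.
  move: Mu; rewrite ltr_pdivlMr ?exprn_gt0 // mulrAC ltr_pdivrMr ?exprn_gt0 //.
  have l2 : 0 < l ^+ 2 by rewrite exprn_gt0.
  have := ler_wpM2r (ltW l2) Phiq; lra.
have T0 : (0 < #|{: 'I_q * bool}|)%N by rewrite card_prod card_ord card_bool muln_gt0 q0.
have [[Om K I xi w c s r tau Om0 K0 cI iid dec ns nr vr _ _]] :=
  sch _ (@ternary R q) _ S sg T0 (@norm_ternary_le1 R q) (@ternary_flip_inj q)
    (@ternary_odd R q) S0 Sd sg0 var.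
have [sample hs] := @sample_exists R Om Om0.
have sm om := proj1 (hs om); have su om := proj2 (hs om).
pose f (k : 'I_#|K|) (t : lebesgueR R) : R := u * xi (enum_val k) (sample t).
have marg := avg_marginal T0 iid.
suff h : (gamma%:E <= l%:E)%E by move: h; rewrite lee_fin leNgt lg.
apply: le_trans (IR #|K| f K0 _ _ _ _) _.
- move=> k; exact: (orlicz_space_sample hPhi Om0 sm su (fun om => u * xi (enum_val k) om)).
- exact: (independent_sample T0 iid sm su).
- move=> k; rewrite (integral_sample sm su (fun om => u * xi (enum_val k) om)).
  rewrite (marg _ (fun x => u * x)); congr _%:E.
  apply: (avg_odd (@ternary_flip_inj q)) => t.
  by rewrite ternary_odd mulrN.
- move=> k; apply: (luxemburg_norm_sample_ge1 sm su (F := fun om => u * xi (enum_val k) om)).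
  (* For e < 1 the average is Phi(u/e)/q, and Phi(u/e) > Phi u >= q. *)
  move=> e e0 e1; rewrite (marg _ (fun x => Phi (`|u * x| / e))).
  rewrite (avg_ternary q0 (phi := fun x => Phi (`|u * x| / e))); last 2 first.
  + by rewrite mulr0 normr0 mul0r (orlicz0 hPhi).
  + by rewrite mulrN normrN.
  rewrite mulr1 gtr0_norm // ltr_pdivlMr; last by lra.
  rewrite mul1r; apply: le_lt_trans qPhi _.
  apply: (orlicz_function_lt hPhi); first exact: ltW.
  by rewrite ltr_pdivlMr // gtr_pMr.
apply: (width_sample_le hPhi Om0 sm su (w := w)).
  by rewrite truncn_ge_nat ?mulr_ge0 // ltW.
move=> _ [k _ <-]; pose kk := enum_val k; exists (fun i => u * c kk i).
have -> : (fun t => (f k t - \sum_i u * c kk i * w i (sample t))) =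
          (fun t => (fun om => u * (s kk om + r kk om)) (sample t)).
  apply/funext => t; rewrite /f dec; under [X in _ - X]eq_bigr do rewrite -mulrA.
  by rewrite -mulr_sumr -/kk; ring.
apply: (luxemburg_norm_sample_le sm su (F := fun om => u * (s kk om + r kk om))) => //.
have P0 : 0 <= P by apply: (orlicz_function_ge0 hPhi); rewrite divr_ge0 ?mulr_ge0 ?ltW.
have uS : 2 * u * S <= l by rewrite /S mulrC divfK // gt_eqF // mulr_gt0.
(* By 2|r|P <= 1 + P^2 r^2 the first moment of the rest is replaced by its variance; the total is at
   most 1/2 + 1/4 + 1/4. *)
apply: (@le_trans _ _ (avg (fun om => 2^-1 + (4^-1 + (P ^+ 2 / 4) * r kk om ^+ 2)))).
  apply: ler_avg => om.
  apply: le_trans (orlicz_function_split hPhi (ltW u0) l0 uS (ns kk om) (nr kk om)) _.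
  rewrite -/P lerD2l; have := sqr_ge0 (`|r kk om| * P - 1).
  by rewrite -[r kk om ^+ 2]real_normK ?num_real //; lra.
rewrite !avgD !avg_cst // avgZ.
have : P ^+ 2 * avg (fun om => r kk om ^+ 2) <= 1.
  apply: le_trans (ler_wpM2l (sqr_ge0 P) (vr kk)) _.
  by rewrite /sg ler_pdivrMr // mul1r; lra.
by lra.
Qed.
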